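(* Every infinite precompact group (in particular, every infinite precompact abelian group) admits an infinite quotient group with weight at most $2^{\mathfrak{c}}$.
   Context: All topological groups are Hausdorff. A topological group $G$ is precompact if for every neighborhood $U$ of the identity there is a finite $F\subseteq G$ with $G=FU$. A quotient group of $G$ is $G/N$ with the quotient topology, where $N$ is a closed normal subgroup. The weight of a space is the least cardinality of a base. $\mathfrak{c}=2^\omega$. *)

(* Defs.v *)
From HB Require Import structures.
From mathcomp Require Import all_boot monoid.
From mathcomp Require Import all_classical topology.

Set Implicit Arguments.
Unset Strict Implicit.
Unset Printing Implicit Defensive.

Local Open Scope classical_set_scope.
Local Open Scope card_scope.
Local Open Scope group_scope.
Local Open Scope quotient_scope.

HB.mixin Record isTopologicalGroup G of Topological G & Group G := {
  mulg_continuous : continuous (fun x : G * G => x.1 * x.2) ;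
  invg_continuous : continuous (fun x : G => x^-1)
}.

(* The Hausdorff axiom is not part of this structure. *)
#[short(type="topologicalGroupType")]
HB.structure Definition TopologicalGroup :=
  {G of Topological G & Group G & isTopologicalGroup G}.

(* Not to be confused with MathComp-Analysis's [precompact], which means
   "has compact closure". *)
Definition precompact_group (G : topologicalGroupType) :=
  forall U : set G, nbhs 1 U ->
    exists2 F : set G, finite_set F & [set: G] = [set x * u | x in F & u in U].

Record normalSubgroup (G : groupType) := NormalSubgroup {
  normal_set :> set G;
  normal1 : normal_set 1;
  normalM : forall x y, normal_set x -> normal_set y -> normal_set (x * y);
  normalV : forall x, normal_set x -> normal_set x^-1;
  normalJ : forall x y, normal_set x -> normal_set (x ^ y)
}.

Section QuotientRelation.
Context (G : groupType) (N : normalSubgroup G).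

Let coset_rel' (x y : G) : bool := `[< normal_set N (x^-1 * y) >].

Local Lemma coset_rel_refl : reflexive coset_rel'.
Proof. by move=> x; apply/asboolP; rewrite mulVg; exact: normal1. Qed.

Local Lemma coset_rel_sym : symmetric coset_rel'.
Proof.
by move=> x y; apply/asboolP/asboolP => /normalV; rewrite invgM invgK.
Qed.

Local Lemma coset_rel_trans : transitive coset_rel'.
Proof.
move=> y x z /asboolP Nxy /asboolP Nyz; apply/asboolP.
by have := normalM Nxy Nyz; rewrite -mulgA mulVKg.
Qed.

Definition coset_rel :=
  EquivRel coset_rel' coset_rel_refl coset_rel_sym coset_rel_trans.

Lemma coset_relE x y : coset_rel x y = `[< normal_set N (x^-1 * y) >].
Proof. by []. Qed.

End QuotientRelation.

(* G/N as the type of left cosets xN, with the quotient topology when G is a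
   topological group. *)
Definition quotient_group (G : topologicalGroupType) (N : normalSubgroup G) :=
  {eq_quot coset_rel N}.

Section QuotientGroup.
Context (G : topologicalGroupType) (N : normalSubgroup G).
Local Notation Q := (quotient_group N).

HB.instance Definition _ := Topological.copy Q (quotient_topology Q).
HB.instance Definition _ := Quotient.on Q.

Lemma pi_cosetP (x y : G) : \pi_Q x = \pi_Q y <-> normal_set N (x^-1 * y).
Proof.
by split=> [/eqmodP|?]; [rewrite coset_relE => /asboolP|
  apply/eqmodP; rewrite coset_relE; exact/asboolP].
Qed.

Let pi_ind (P : Q -> Prop) : (forall x, P (\pi_Q x)) -> forall a, P a.
Proof. by move=> Ppi a; rewrite -(reprK a). Qed.

Let mulq (a b : Q) : Q := \pi_Q (repr a * repr b).
Let invq (a : Q) : Q := \pi_Q (repr a)^-1.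

Let repr_pi (x : G) : normal_set N (x^-1 * repr (\pi_Q x)).
Proof. by apply/pi_cosetP; rewrite reprK. Qed.

Let pi_mulq (x y : G) : mulq (\pi_Q x) (\pi_Q y) = \pi_Q (x * y).
Proof.
apply/esym/pi_cosetP; set x' := repr _; set y' := repr _.
have -> : (x * y)^-1 * (x' * y') = ((x^-1 * x') ^ y) * (y^-1 * y').
  by rewrite /conjg invgM !mulgA mulgK.
by apply: normalM; [apply: normalJ|]; exact: repr_pi.
Qed.

Let pi_invq (x : G) : invq (\pi_Q x) = \pi_Q x^-1.
Proof.
apply/pi_cosetP; set x' := repr _; rewrite invgK.
have -> : x' * x^-1 = (x^-1 * x') ^ x^-1 by rewrite /conjg invgK !mulgA mulgV mul1g.
by apply: normalJ; exact: repr_pi.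
Qed.

Let mulqA : associative mulq.
Proof.
move=> a b c; elim/pi_ind: a => x; elim/pi_ind: b => y; elim/pi_ind: c => z.
by rewrite !pi_mulq mulgA.
Qed.

Let mul1q : left_id (\pi_Q 1) mulq.
Proof. by move=> a; elim/pi_ind: a => x; rewrite pi_mulq mul1g. Qed.

Let mulq1 : right_id (\pi_Q 1) mulq.
Proof. by move=> a; elim/pi_ind: a => x; rewrite pi_mulq mulg1. Qed.

Let mulVq : left_inverse (\pi_Q 1) invq mulq.
Proof. by move=> a; elim/pi_ind: a => x; rewrite pi_invq pi_mulq mulVg. Qed.

Let mulqV : right_inverse (\pi_Q 1) invq mulq.
Proof. by move=> a; elim/pi_ind: a => x; rewrite pi_invq pi_mulq mulgV. Qed.

HB.instance Definition _ := isGroup.Build Q mulqA mul1q mulq1 mulVq mulqV.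

Lemma pi_cosetM (x y : G) : \pi_Q (x * y) = \pi_Q x * \pi_Q y.
Proof. by rewrite -pi_mulq. Qed.

Lemma pi_cosetV (x : G) : \pi_Q x^-1 = (\pi_Q x)^-1.
Proof. by rewrite -pi_invq. Qed.

Lemma pi_coset_continuous : continuous (\pi_Q : G -> Q).
Proof. exact: pi_continuous. Qed.

Lemma pi_coset_open (A : set G) : open A -> open (\pi_Q @` A : set Q).
Proof.
move=> oA; rewrite /open /= /quotient_open.
have -> : \pi_Q @^-1` (\pi_Q @` A) = \bigcup_(n in N) ((fun x => x * n) @^-1` A).
  apply/seteqP; split=> [x [a Aa /esym/pi_cosetP Nxa]|x [n Nn /= Axn]].
    by exists (x^-1 * a) => //=; rewrite mulVKg.
  by exists (x * n) => //; apply/esym/pi_cosetP; rewrite mulKg.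
apply: bigcup_open => n _; apply: open_comp => // x _.
apply: (@continuous_comp _ _ _ (fun x => (x, n)) (fun z : G * G => z.1 * z.2)).
  by apply: cvg_pair => /=; [exact: cvg_id|exact: cvg_cst].
exact: mulg_continuous.
Qed.

Let nbhs_pi (x : G) (A : set G) : nbhs x A -> nbhs (\pi_Q x) (\pi_Q @` A).
Proof.
rewrite nbhsE => -[B [oB Bx] BA]; rewrite nbhsE.
exists (\pi_Q @` B); last exact: image_subset.
by split; [exact: pi_coset_open|exists x].
Qed.

Let mulq_continuous : continuous (fun z : Q * Q => z.1 * z.2).
Proof.
move=> -[a b]; elim/pi_ind: a => x; elim/pi_ind: b => y U /=.
rewrite -pi_cosetM => /pi_coset_continuous/(@mulg_continuous G (x, y)).
case=> -[/= A B] [/= Ax By] ABU.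
exists (\pi_Q @` A, \pi_Q @` B); first by split; exact: nbhs_pi.
move=> -[_ _] [/= [a Aa <-] [b Bb <-]] /=.
by rewrite -pi_cosetM; exact: (ABU (a, b)).
Qed.

Let invq_continuous : continuous (fun a : Q => a^-1).
Proof.
move=> a; elim/pi_ind: a => x U.
rewrite -pi_cosetV => /pi_coset_continuous/(@invg_continuous G x)/nbhs_pi.
apply: filterS => _ [y Uy <-] /=.
by rewrite -pi_cosetV.
Qed.

HB.instance Definition _ :=
  isTopologicalGroup.Build Q mulq_continuous invq_continuous.

End QuotientGroup.

(* The library has no type of cardinals: the weight of T is represented by a
   base of least cardinality, and a cardinal bound by a set K of that size. *)
Definition least_basis (T : topologicalType) (B : set (set T)) :=
  basis B /\ forall B' : set (set T), basis B' -> B #<= B'.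

Definition weight_le (T : topologicalType) (U : Type) (K : set U) :=
  exists2 B : set (set T), least_basis B & B #<= K.

(* Main.v *)
Require Import Defs.
From mathcomp Require Import finmap all_boot monoid.
From mathcomp Require Import all_classical topology.

Set Implicit Arguments.
Unset Strict Implicit.
Unset Printing Implicit Defensive.

Local Open Scope classical_set_scope.

(** The quotient is found without any representation theory: it suffices to
    produce a closed normal subgroup [N] of infinite index such that [G/N] has
    at most the cardinality of the continuum, because the open sets of a space
    with at most that many points form a base of cardinality at most
    [2^(2^omega)].

    In a precompact group every neighborhood of [1] contains one that is
    invariant under conjugation ([nbhs1_conj_invariant]). Given neighborhoods
    [U 0, U 1, ...] of [1], one can therefore choose conjugation-invariant
    neighborhoods [V n] inside [U n] with [V n.+1 ^-1 * V n.+1] inside [V n];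
    their intersection [N] is a closed normal subgroup. Since [G] is covered by
    finitely many translates of each [V n], the coset [x N] is determined by
    the sequence recording, for each [n], the translate of [V n] that contains
    [x], whence a bound on the cardinality of [G/N]
    ([closed_normal_subgroup_sequence]). Finally, for an injective sequence
    [e 0, e 1, ...] in [G], choose the sets [U n] so that each point
    [(e i)^-1 * e j], [i <> j], is missing from one of them. Then the [e i] lie
    in distinct cosets of [N], and [G/N] is infinite.

    That the weight is attained by some base rests on the well-ordering of
    cardinals ([exists_min_card]). *)

(** * Cardinals and weight *)

(** Cardinals are well-ordered. By Zorn's lemma there is a maximal set [R] of
    elements of the product of the [F i] on which all the projections are
    injective; by maximality one of the projections is onto, so the
    corresponding [F i] is no larger than [R], hence no larger than any
    [F j]. *)
Lemma exists_min_card (I T : Type) (F : I -> set T) (i0 : I) :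
  exists i, forall j, (F i #<= F j)%card.
Proof.
pose P (R : set (I -> T)) :=
  (forall f, R f -> forall i, F i (f i)) /\
  (forall f g, R f -> R g -> forall i, f i = g i -> f = g).
have [C CP Ctot|R [[RF Rinj] Rmax]] := @Zorn_bigcup _ P.
  split=> [f [X CX Xf]|f g [X CX Xf] [Y CY Yg]]; first exact: (CP _ CX).1.
  case: (Ctot _ _ CX CY) => XY.
    by apply: (CP _ CY).2 => //; exact: XY.
  by apply: (CP _ CX).2 => //; exact: XY.
have [i iR] : exists i, F i `<=` (fun f => f i) @` R.
  apply: contrapT => /forallNP nsurj.
  have {nsurj}/choice[h hP] : forall i, exists x, F i x /\
      ~ ((fun f => f i) @` R) x.
    by move=> i; have /existsNP[x /not_implyP[]] := nsurj i; exists x.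
  have Rh : ~ R h by move=> Rh; apply: (hP i0).2; exists h.
  apply: (Rmax (R `|` [set h])); first split.
  - by move=> f Rf; left.
  - by move=> sub; apply: Rh; apply: sub; right.
  - split=> [f [/RF//|-> i]|f g]; first exact: (hP i).1.
    move=> [Rf|->] [Rg|->] // i e; first exact: Rinj e.
    + by case: (hP i).2; exists f.
    + by case: (hP i).2; exists g.
exists i => j.
apply: (card_le_trans (subset_card_le iR)).
apply: (card_le_trans (card_image_le _ _)).
have inj : {in R &, injective (fun f : I -> T => f j)}.
  by move=> f g /set_mem Rf /set_mem Rg; exact: Rinj.
have := inj_card_eq inj; rewrite card_eq_sym => /card_eqPle[le _].
by apply: (card_le_trans le); apply: subset_card_le => _ [f Rf <-]; exact: RF.
Qed.

Lemma basis_open (T : topologicalType) : basis (@open T).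
Proof.
split=> // x A; rewrite nbhsE => -[B [oB Bx] BA].
by exists B.
Qed.

Lemma exists_least_basis (T : topologicalType) :
  exists B : set (set T), least_basis B.
Proof.
have [[B bB] Bmin] := exists_min_card
  (fun B : {B : set (set T) | basis B} => sval B) (exist _ _ (basis_open T)).
by exists B; split=> // B' bB'; exact: (Bmin (exist _ _ bB')).
Qed.

(** A space with at most [#|K|] points has weight at most [2^#|K|]. *)
Lemma weight_le_power (T : topologicalType) (K : Type) (f : T -> K) :
  injective f -> weight_le T [set: set K].
Proof.
move=> finj; have [B lB] := exists_least_basis T; exists B => //.
apply: (card_le_trans (lB.2 _ (basis_open T))).
apply/pcard_injP; exists (fun A => f @` A) => A A' _ _ eqA.
have imK (C : set T) : f @^-1` (f @` C) = C.
  by apply/seteqP; split=> [x [y Cy /finj <-]|x Cx] //; exists x.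
by rewrite -(imK A) eqA imK.
Qed.

(** * Neighborhoods of the identity *)

Local Open Scope group_scope.

Section TopologicalGroup.
Context (G : topologicalGroupType).

Lemma continuous_mulgl (a : G) : continuous (fun x : G => a * x).
Proof.
move=> x; apply: (@continuous_comp _ _ _ (fun x => (a, x))
  (fun z : G * G => z.1 * z.2)); last exact: mulg_continuous.
by apply: cvg_pair => /=; [exact: cvg_cst|exact: cvg_id].
Qed.

Lemma continuous_mulgr (a : G) : continuous (fun x : G => x * a).
Proof.
move=> x; apply: (@continuous_comp _ _ _ (fun x => (x, a))
  (fun z : G * G => z.1 * z.2)); last exact: mulg_continuous.
by apply: cvg_pair => /=; [exact: cvg_id|exact: cvg_cst].
Qed.

Lemma continuous_conjg (a : G) : continuous (fun x : G => x ^ a).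
Proof.
move=> x; apply: (@continuous_comp _ _ _ (fun x => x * a) (fun x => a^-1 * x)).
  exact: continuous_mulgr.
exact: continuous_mulgl.
Qed.

Lemma nbhs1_mulVg (U : set G) : nbhs 1 U ->
  exists2 W, nbhs 1 W & forall x y, W x -> W y -> U (x^-1 * y).
Proof.
move=> U1.
have : nbhs (1 : G, 1 : G) [set z | U (z.1 * z.2)].
  by apply: (@mulg_continuous G (1, 1)); rewrite /= mulg1.
move=> [[A B] [/= A1 B1] AB].
exists ([set x | A x^-1] `&` B).
  apply: filterI => //; apply: (@invg_continuous G 1).
  by rewrite invg1.
by move=> x y [Ax _] [_ By]; exact: (AB (x^-1, y)).
Qed.

Lemma nbhs1_conj (U : set G) : precompact_group G -> nbhs 1 U ->
  exists2 V, nbhs 1 V & forall x y, V x -> U (x ^ y).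
Proof.
move=> pG U1.
have [W1 W11 W1U] := nbhs1_mulVg U1.
have [W W_1 WW1] := nbhs1_mulVg W11.
have W_W1 x : W x -> W1 x.
  by have := WW1 1 x (nbhs_singleton W_1); rewrite invg1 mul1g.
have [F finF GFW] := pG W W_1.
have [D FD] := finite_fsetP.1 finF.
exists (\bigcap_(f in [set` D]) [set x | W (x ^ f)]).
  apply: filter_bigI => f _; apply: continuous_conjg.
  by rewrite conj1g.
move=> x y Vx.
(* y = f * w with f in F and w in W, so x ^ y is x ^ f conjugated by w *)
have : [set: G] y by [].
rewrite GFW => -[f Ff [w Ww <-]].
have Wxf : W (x ^ f) by apply: Vx; rewrite -FD.
have -> : x ^ (f * w) = ((x ^ f)^-1 * w)^-1 * w.
  by rewrite conjgM invgM invgK /conjg !mulgA.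
apply: W1U; first exact: WW1.
exact: W_W1.
Qed.

Lemma nbhs1_conj_invariant (U : set G) : precompact_group G -> nbhs 1 U ->
  exists V, [/\ nbhs 1 V, forall x y, V x -> V (x ^ y) &
                forall x y, V x -> V y -> U (x^-1 * y)].
Proof.
move=> pG /nbhs1_mulVg[W /(nbhs1_conj pG)[V V1 VW] WU].
exists [set x | forall y, W (x ^ y)]; split.
- by apply: filterS V1 => x Vx y; exact: VW.
- by move=> x y Wx z; rewrite -conjgM.
- by move=> x y /(_ 1) + /(_ 1); rewrite !conjg1; exact: WU.
Qed.

(** * Closed normal subgroups of index at most the continuum *)

(** The values of [c] encode the sequences of translates. Only one implication
    is stated: [c] need not be constant on the cosets of [N], so an injection
    of [G/N] into [set nat] is obtained by applying [c] to representatives. *)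
Lemma closed_normal_subgroup_sequence (U : nat -> set G) :
  precompact_group G -> (forall n, nbhs 1 (U n)) ->
  exists N : normalSubgroup G,
    [/\ closed N, forall n, N `<=` U n &
        exists c : G -> set nat, forall x y, c x = c y -> normal_set N (x^-1 * y)].
Proof.
move=> pG U1.
have /choice[step stepP] : forall A : set G, exists V, nbhs 1 A ->
    [/\ nbhs 1 V, forall x y, V x -> V (x ^ y) &
        forall x y, V x -> V y -> A (x^-1 * y)].
  move=> A; have [/(nbhs1_conj_invariant pG)[V]|nA] := pselect (nbhs 1 A).
    by exists V.
  by exists A.
pose V := fix V n := if n is m.+1 then step (V m `&` U n) else step (U 0).
have V1 n : nbhs 1 (V n).
  elim: n => [|n IH] /=; first by have [] := stepP _ (U1 0).
  by have [] := stepP _ (filterI IH (U1 n.+1)).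
have VJ n x y : V n x -> V n (x ^ y).
  case: n => [|n] /=; first by have [_ + _] := stepP _ (U1 0); apply.
  by have [_ + _] := stepP _ (filterI (V1 n) (U1 n.+1)); apply.
have VS n x y : V n.+1 x -> V n.+1 y -> V n (x^-1 * y).
  have [_ _ VV] := stepP _ (filterI (V1 n) (U1 n.+1)).
  by move=> Vx Vy; have [] := VV x y Vx Vy.
(* x = 1^-1 * x, with both 1 and x in V n *)
have VU n : V n `<=` U n.
  move=> x Vx; rewrite -[x]mul1g -invg1.
  have := nbhs_singleton (V1 n).
  case: n Vx => [|n] /= Vx Vn1; first by have [_ _] := stepP _ (U1 0); apply.
  have [_ _ VV] := stepP _ (filterI (V1 n) (U1 n.+1)).
  by have [] := VV 1 x Vn1 Vx.
have VV n x : V n.+1 x -> V n x^-1.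
  by move=> Vx; rewrite -[x^-1]mulg1; apply: VS Vx (nbhs_singleton (V1 _)).
have N1 : forall n, V n 1 by move=> n; exact: nbhs_singleton.
have NM x y : (forall n, V n x) -> (forall n, V n y) -> forall n, V n (x * y).
  by move=> Nx Ny n; rewrite -[x]invgK; apply: VS => //; exact: VV.
have NV x : (forall n, V n x) -> forall n, V n x^-1 by move=> Nx n; exact: VV.
have NJ x y : (forall n, V n x) -> forall n, V n (x ^ y).
  by move=> Nx n; exact: VJ.
exists (NormalSubgroup N1 NM NV NJ); split=> [x clx /= n|n x /(_ n)/VU//|].
- have : nbhs x [set y | V n.+2 (x^-1 * y)].
    by apply: continuous_mulgl; rewrite mulVg.
  move=> /clx[y [/= Ny Vxy]].
  (* x = (y^-1)^-1 * (x^-1 * y)^-1 *)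
  rewrite -[x](mulgK (x^-1 * y)) mulVKg -[y in y * _]invgK.
  by apply: VS; [exact: (NV _ Ny)|exact: VV].
- have /choice[s sP] : forall n, exists s : G -> nat,
      forall x y, s x = s y -> V n (x^-1 * y).
    move=> n; have [F finF GFV] := pG _ (V1 n.+1).
    have /countable_injP[g ginj] := finite_set_countable finF.
    have /choice[t tP] : forall x : G, exists f, F f /\ V n.+1 (f^-1 * x).
      move=> x; have : [set: G] x by [].
      by rewrite GFV => -[f Ff [v Vv <-]]; exists f; rewrite mulKg.
    exists (g \o t) => x y /= /ginj txy.
    have [Fx Vx] := tP x; have [Fy Vy] := tP y.
    move: Vy; rewrite -txy ?inE// => Vy.
    by have := VS _ _ _ Vx Vy; rewrite invgM invgK -mulgA mulVKg.
  (* the code of x is the graph of the sequence s _ x *)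
  exists (fun x => [set m | exists n, m = pickle (n, s n x)]).
  move=> x y eqc /= n; apply: sP.
  have : [set m | exists n, m = pickle (n, s n x)] (pickle (n, s n x)).
    by exists n.
  by rewrite eqc => -[k /(pcan_inj pickleK)[->]].
Qed.

End TopologicalGroup.

Local Close Scope group_scope.
Unset Implicit Arguments.

(* 2^c is the cardinality of [set (set nat)], i.e. of P(P(nat)). *)
Theorem proposition1p2 (G : topologicalGroupType) :
  hausdorff_space G -> precompact_group G -> infinite_set [set: G] ->
  exists N : normalSubgroup G,
    [/\ closed N,
        infinite_set [set: quotient_group N] &
        weight_le (quotient_group N) [set: set (set nat)]].
Proof.
move=> hG pG /infiniteP/pcard_surjP[g gsurj].
have /choice[e eK] : forall n : nat, exists x, g x = n.
  by move=> n; have [x _ <-] := gsurj n I; exists x.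
have einj : injective e := can_inj eK.
pose U n := [set x : G | forall i j, n = pickle (i, j) -> i <> j ->
  x <> ((e i)^-1 * e j)%g].
have U1 n : nbhs (1%g : G) (U n).
  case E : (unpickle n : option (nat * nat)) => [[i j]|]; last first.
    by apply: filterS filterT => x _ i j nE; move: E; rewrite nE pickleK.
  have [ij|ij] := pselect (i = j).
    apply: filterS filterT => x _ i' j' nE.
    by move: E; rewrite nE pickleK => -[-> ->].
  have : nbhs (1%g : G) (~` [set ((e i)^-1 * e j)%g]).
    apply: open_nbhs_nbhs; split.
      by apply/closed_openC/accessible_closed_set1/hausdorff_accessible.
    move=> /= eij; apply: ij; apply: einj.
    by rewrite -[RHS](mulVKg (e i)) -eij mulg1.
  apply: filterS => x xij i' j' nE _.
  by move: E; rewrite nE pickleK => -[-> ->].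
have [N [clN NU [c cP]]] := closed_normal_subgroup_sequence pG U1.
exists N; split=> //.
- apply/infiniteP.
  have piinj : {in [set: nat] &,
      injective (fun i => \pi_(quotient_group N)%qT (e i))}.
    move=> i j _ _ /pi_cosetP Nij; apply: contrapT => ij.
    exact: (NU (pickle (i, j)) _ Nij i j erefl ij).
  have := inj_card_eq piinj; rewrite card_eq_sym => /card_eqPle[le _].
  exact: card_le_trans le (card_leT _).
- apply: (@weight_le_power _ _ (fun a : quotient_group N => c (repr a))).
  by move=> a b /cP/pi_cosetP; rewrite !reprK.
Qed.
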